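(* Let $q$ be a prime power and let $\pi\colon SL(2,\mathbb{F}_q)\times SL(2,\mathbb{F}_q)\to \mathbb{F}_q^3$ be the map $\pi(x,y)=(\operatorname{tr}(x),\operatorname{tr}(xy),\operatorname{tr}(y))$. Then for every $(s_0,u_0,t_0)\in\mathbb{F}_q^3$ the set $\pi^{-1}(s_0,u_0,t_0)\subset SL(2,\mathbb{F}_q)^2$ is nonempty.
   Context: $\mathbb{F}_q$ is the finite field with $q$ elements; $\operatorname{tr}$ is the trace of a $2\times 2$ matrix. *)

(* Defs.v *)
From HB Require Import structures.
From mathcomp Require Import all_boot all_order all_algebra.
Set Implicit Arguments.
Unset Strict Implicit.
Unset Printing Implicit Defensive.
Import GRing.Theory.
Local Open Scope ring_scope.

(* Only the underlying (finite) set of SL(2, F) is needed; products are taken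
   in 'M[F]_2. *)
Definition SL2 (F : finFieldType) : finType := {x : 'M[F]_2 | \det x == 1}.

Definition tr_map (F : finFieldType) (z : SL2 F * SL2 F) : F * F * F :=
  (\tr (val z.1), \tr (val z.1 *m val z.2), \tr (val z.2)).

(* Main.v *)
Require Import Defs.
From HB Require Import structures.
From mathcomp Require Import all_boot all_order all_algebra.
From mathcomp Require Import ring.
Set Implicit Arguments.
Unset Strict Implicit.
Unset Printing Implicit Defensive.
Import GRing.Theory.
Local Open Scope ring_scope.

(** Take for [x] the companion matrix with rows [(s, -1)] and [(1, 0)], and let
[y] have first column [(a, c)].  The conditions on [tr y] and [tr (x y)]
determine the second column, and [det y = 1] becomes the affine conic
[a^2 - s a c + c^2 - t a + u c + 1 = 0].  If [s^2 <> 4], this conic has a point: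
in odd characteristic, after completing squares, because a nondegenerate binary
diagonal form over a finite field represents every element (pigeonhole), and in
characteristic 2 because squaring is bijective.  If [s = 2 e] with [e = 1] or
[e = -1], the conic has a point when [u <> e t]; when [u = e t] it may be empty,
and [x = e I] works instead. *)

Definition squares (F : finFieldType) : {set F} := [set x ^+ 2 | x : F].

(* [F] is covered by a choice of square roots and its opposite, which share 0. *)
Lemma card_squares (F : finFieldType) : (#|F| < #|squares F| + #|squares F|)%N.
Proof.
pose g (y : F) := odflt 0 [pick x | x ^+ 2 == y].
have gK x : g (x ^+ 2) ^+ 2 = x ^+ 2.
  by rewrite /g; case: pickP => [z /eqP //|/(_ x)]; rewrite eqxx.
pose A : {set F} := g @: squares F.
pose B : {set F} := (fun y => - g y) @: squares F.
have memA x : g (x ^+ 2) \in A by do 2!apply: imset_f.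
have memB x : - g (x ^+ 2) \in B.
  by apply: (imset_f (fun y => - g y)); apply: imset_f.
have AUB : A :|: B = [set: F].
  apply/setP=> x; rewrite !inE; apply/orP.
  have /eqP := gK x; rewrite eqf_sqr => /orP[]/eqP gx.
    by left; rewrite -gx.
  by right; rewrite -[x]opprK -gx.
have AIB : 0 \in A :&: B.
  have g0 : g (0 ^+ 2) = 0 by apply/eqP; rewrite -sqrf_eq0 gK expr0n.
  by have := (memA 0, memB 0); rewrite g0 oppr0 inE => -[-> ->].
have leAB : (#|A| + #|B| <= #|squares F| + #|squares F|)%N.
  by apply: leq_add; apply: leq_imset_card.
apply: leq_trans leAB; rewrite -cardsUI AUB cardsT -addn1 leq_add2l.
by apply/card_gt0P; exists 0.
Qed.

(** [squares F] and its image under the injection [z => n - d * z] each fill more than half of [F],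
    so they meet. *)
Lemma diagonal_form_universal (F : finFieldType) (d n : F) :
  d != 0 -> exists x y : F, d * x ^+ 2 + y ^+ 2 = n.
Proof.
move=> d0; pose A : {set F} := (fun z => n - d * z) @: squares F.
have cA : #|A| = #|squares F|.
  by apply: card_imset => y z /addrI /oppr_inj /(mulfI d0).
have [z] : exists z, z \in A :&: squares F.
  apply/card_gt0P; rewrite -(ltn_add2l #|A :|: squares F|) addn0 cardsUI cA.
  exact: leq_ltn_trans (max_card _) (card_squares F).
rewrite inE => /andP[/imsetP[_ /imsetP[x _ ->] ->] /imsetP[y _ xy]].
by exists x, y; rewrite -xy; ring.
Qed.

Lemma sqr_surj_char2 (F : finFieldType) (n : F) :
  2%:R = 0 :> F -> exists x : F, x ^+ 2 = n.
Proof.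
move=> F2; have sqrI : injective (fun x : F => x ^+ 2).
  move=> x y /= xy; apply/eqP; rewrite -subr_eq0 -sqrf_eq0; apply/eqP.
  have -> : (x - y) ^+ 2 = (x ^+ 2 - y ^+ 2) + 2%:R * (y ^+ 2 - x * y) by ring.
  by rewrite xy F2 subrr mul0r addr0.
by have [f _ fK] := injF_bij sqrI; exists (f n); apply: fK.
Qed.

Lemma conic_point (F : finFieldType) (s u t : F) : s ^+ 2 != 4%:R ->
  exists a c : F, a ^+ 2 - s * a * c + c ^+ 2 - t * a + u * c + 1 = 0.
Proof.
move=> s4; have [F2|F2] := eqVneq (2%:R : F) 0.
  have s0 : s != 0.
    apply: contraNneq s4 => ->.
    by rewrite expr0n (natrM F 2 2) F2 mulr0.
  (* With [s c = - t] the terms [- s a c] and [- t a] cancel. *)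
  pose c := - t / s.
  have [a aE] := sqr_surj_char2 (- (c ^+ 2 + u * c + 1)) F2.
  by exists a, c; rewrite aE /c; field.
(* With [X = 2 a - s c - t] and [Y = D c + 2 u - s t], the conic's left side times [4 D] is
   [D X^2 + Y^2] minus the constant represented here. *)
pose D := 4%:R - s ^+ 2; have D0 : D != 0 by rewrite subr_eq0 eq_sym.
have [X [Y XY]] := diagonal_form_universal
  ((2%:R * u - s * t) ^+ 2 - D * (4%:R - t ^+ 2)) D0.
pose c := (Y - 2%:R * u + s * t) / D; pose a := (X + s * c + t) / 2%:R.
exists a, c.
have XE : X = 2%:R * a - s * c - t by rewrite /a; field.
have YE : Y = D * c + 2%:R * u - s * t by rewrite /c; field.
apply: (mulfI D0); apply: (mulfI F2); apply: (mulfI F2); rewrite !mulr0.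
rewrite -(subrr (D * X ^+ 2 + Y ^+ 2)) {2}XY XE YE /D; ring.
Qed.

Definition mx2 (R : nzRingType) (a b c d : R) : 'M[R]_2 :=
  \matrix_(i, j) if i == 0 then if j == 0 then a else b
                 else if j == 0 then c else d.

Lemma det_mx2 (R : comNzRingType) (a b c d : R) :
  \det (mx2 a b c d) = a * d - b * c.
Proof.
rewrite (expand_det_row _ ord0) !big_ord_recl big_ord0 /cofactor !det_mx11 !mxE.
by rewrite /= expr0 expr1; ring.
Qed.

Lemma mxtrace_mx2 (R : nzRingType) (a b c d : R) : \tr (mx2 a b c d) = a + d.
Proof. by rewrite /mxtrace !big_ord_recl big_ord0 !mxE addr0. Qed.

Lemma mxtrace_mul_mx2 (R : nzRingType) (a b c d a' b' c' d' : R) :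
  \tr (mx2 a b c d *m mx2 a' b' c' d') = a * a' + b * c' + (c * b' + d * d').
Proof.
rewrite /mxtrace !big_ord_recl big_ord0 !mxE !big_ord_recl !big_ord0 !mxE.
by rewrite !addr0.
Qed.

Definition in_tr_image (F : finFieldType) (s u t : F) :=
  exists x y : 'M[F]_2,
    [/\ \det x = 1, \det y = 1, \tr x = s, \tr (x *m y) = u & \tr y = t].

Lemma in_tr_image_conic (F : finFieldType) (s u t a c : F) :
  a ^+ 2 - s * a * c + c ^+ 2 - t * a + u * c + 1 = 0 -> in_tr_image s u t.
Proof.
(* With [b] the top right entry of [y], [tr (x y) = s a - c + b], which fixes [b]. Then [det y] is 1
   minus the left side of [ac0]. *)
move=> ac0; exists (mx2 s (-1) 1 0), (mx2 a (c + u - s * a) c (t - a)).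
rewrite !det_mx2 mxtrace_mul_mx2 !mxtrace_mx2; split; try ring.
by rewrite -[RHS]subr0 -ac0; ring.
Qed.

Lemma in_tr_image_double_unit (F : finFieldType) (e u t : F) :
  e ^+ 2 = 1 -> in_tr_image (2%:R * e) u t.
Proof.
move=> e2; have [->|ut] := eqVneq u (e * t).
  (* Since [x = e I], [tr (x y) = e tr y] for every [y]; any [y] of determinant 1 and trace [t] will
     do. *)
  exists (mx2 e 0 0 e), (mx2 t (-1) 1 0).
  rewrite !det_mx2 mxtrace_mul_mx2 !mxtrace_mx2.
  by split; try ring; rewrite -e2; ring.
(* On the line [a = e c] the quadratic part vanishes and the rest is affine. *)
have ut0 : e * t - u != 0 by rewrite subr_eq0 eq_sym.
pose c := (e * t - u)^-1.
apply: (@in_tr_image_conic _ _ _ _ (e * c) c).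
transitivity ((1 - e ^+ 2) * c ^+ 2 - (e * t - u) * c + 1); first ring.
by rewrite e2 /c divff //; ring.
Qed.

Lemma in_tr_imageT (F : finFieldType) (s u t : F) : in_tr_image s u t.
Proof.
have [|/(conic_point u t)[a [c]]] := eqVneq (s ^+ 2) 4%:R; last first.
  exact: in_tr_image_conic.
rewrite (_ : 4%:R = 2%:R ^+ 2); last by ring.
move/eqP; rewrite eqf_sqr => /orP[]/eqP ->.
  by rewrite -[2%:R]mulr1; apply: in_tr_image_double_unit; rewrite expr1n.
by rewrite -mulrN1; apply: in_tr_image_double_unit; rewrite sqrrN expr1n.
Qed.

Theorem mainTheorem1 (p k q : nat) (p_prime : prime p) (k_gt0 : (0 < k)%N)
    (q_def : q = (p ^ k)%N) (F : finFieldType) (cardF : #|F| = q)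
    (s0 u0 t0 : F) :
  @tr_map F @^-1: [set (s0, u0, t0)] != set0.
Proof.
have [x [y [/eqP dx /eqP dy sx uxy ty]]] := in_tr_imageT s0 u0 t0.
apply/set0Pn; exists ((Sub x dx : SL2 F), (Sub y dy : SL2 F)).
by rewrite !inE /tr_map /= sx uxy ty.
Qed.
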